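(* The letters $0$ and $1$ each have frequency $\tfrac12$ in the sequence $x_\beta=(x_\beta(N))_{N\ge0}$.
   Context: Let $\varphi=(1+\sqrt5)/2$ be the golden mean. Every integer $N\ge 0$ can be written uniquely as $N=\sum_{i\in\mathbb Z} d_i\varphi^i$ with digits $d_i=d_i(N)\in\{0,1\}$, only finitely many of them nonzero, and with $d_id_{i+1}=0$ for all $i$. This is the base phi expansion of $N$. The sum of digits function is $s_\beta(N)=\sum_{i} d_i(N)$, and $x_\beta(N)\in\{0,1\}$ is $s_\beta(N)$ reduced modulo 2. The frequency of a letter $a$ in the sequence is $\lim_{M\to\infty}\frac1M\#\{0\le N<M: x_\beta(N)=a\}$ (the assertion includes that this limit exists). *)

(* Defs.v *)
From HB Require Import structures.
From mathcomp Require Import all_boot all_order all_algebra.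
From mathcomp Require Import all_classical all_reals all_analysis.

Set Implicit Arguments.
Unset Strict Implicit.
Unset Printing Implicit Defensive.
Import Order.TTheory GRing.Theory Num.Theory.
Import numFieldNormedType.Exports.
Local Open Scope classical_set_scope.
Local Open Scope ring_scope.

Definition golden_mean (R : realType) : R := (1 + Num.sqrt 5) / 2.

(* Digits in {0, 1} are booleans, coerced to nat.  The last sum is genuinely
   the sum over all i because its support is that of d, which is finite. *)
Definition is_base_phi_expansion (R : realType) (N : nat) (d : int -> bool) :
    Prop :=
  [/\ finite_set [set i | d i],
      forall i : int, (d i * d (i + 1)%R = 0)%N
    & N%:R = \sum_(i \in [set: int]) (d i)%:R * golden_mean R ^ i].

(* Every N has exactly one such expansion, so the default value is never
   used and the choice is determined. *)
Definition base_phi_digits (R : realType) (N : nat) : int -> bool :=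
  xget (fun=> false) [set d | is_base_phi_expansion R N d].

Definition s_beta (R : realType) (N : nat) : nat :=
  \big[addn/0%N]_(i \in [set: int]) nat_of_bool (base_phi_digits R N i).

Definition x_beta (R : realType) (N : nat) : nat := (s_beta R N %% 2)%N.

(* The term at M = 0 is the junk value 0 / 0 = 0, irrelevant to the limit. *)
Definition has_frequency (R : realType) (x : nat -> nat) (a : nat) (f : R) :
    Prop :=
  (fun M : nat => #|[pred N : 'I_M | x N == a]|%:R / M%:R : R) @ \oo --> f.

(* Main.v *)
Require Import Defs.
From mathcomp Require Import all_boot all_order all_algebra.
From mathcomp Require Import all_classical all_reals all_analysis.
From mathcomp Require Import zify ring lra.

(** Let e(N) = (-1)^s_beta(N) and D(M) = sum of e(N) over N < M.  The number of
    N < M with x_beta(N) = a is (M + (-1)^a D(M)) / 2, so the theorem says that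
    D(M) = o(M).

    The base phi expansions have a recursive structure governed by the Lucas
    numbers L_(2n) = phi^(2n) + phi^(-2n) and
    L_(2n+1) = phi^(2n+1) - phi^(-2n-1).  Two kinds of numbers are followed
    together: the integers k with 0 <= k <= L_(2n+1), which are the natural
    numbers whose expansion uses exponents between -2n and 2n only, and the
    numbers k - phi^(-2n) with 1 <= k < L_(2n), which are expanded with
    exponents between -2n+1 and 2n-1.  Each kind, at level n+1, is cut into
    three consecutive blocks, and each block is a run of a lower level to which
    at most one power of phi is added on each side of the old exponents:
    - for integers, the first block is level n itself, and the identities behind
      the other two are
      L_(2n+1) + k = phi^(2n+1) + (k - phi^(-2n)) + phi^(-2n-2) and
      L_(2n+2) + k = phi^(2n+2) + k + phi^(-2n-2);
    - for shifted integers at level n+1, the three blocks come from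
      k - phi^(-2n-2) = (k - phi^(-2n)) + phi^(-2n-1),
      L_(2n) + k - phi^(-2n-2) = phi^(2n) + k + phi^(-2n-1) and
      L_(2n+1) + k - phi^(-2n-2) = phi^(2n+1) + (k - phi^(-2n)).
    By uniqueness of expansions ([phi_sum_inj]) the lists built in this way
    compute s_beta ([s_beta_expansions]).

    Adding two digits keeps the parity and adding one flips it.  So the sums of
    signs T_n (integers) and Q_n (shifted integers) satisfy
    T_(n+1) = 2 T_n + Q_n and Q_(n+1) = T_(n-1) - 2 Q_n.  The opposite signs of
    the two coefficients 2 produce the cancellation
    T_(n+2) = 4 T_n + T_(n-1), whose characteristic roots are at most 2.12 in
    modulus, whereas the number of integers at level n grows like
    phi^(2n) = 2.618...^n.  Every partial sum is a sum of boundedly many block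
    sums per level, so D inherits this bound ([prefix_bounded_expansions]), and
    the rates 9/4 and 5/2, which lie on the right sides of 2.12 and 2.618, are
    enough for D(M) / M to tend to 0 ([discrepancy_small]). *)

Set Implicit Arguments.
Unset Strict Implicit.
Unset Printing Implicit Defensive.
Import Order.TTheory GRing.Theory Num.Theory.
Import numFieldNormedType.Exports.
Local Open Scope classical_set_scope.
Local Open Scope ring_scope.

(** * Expansions as decreasing lists of exponents *)

(** An expansion is encoded by the list of its exponents, largest first;
    [pairwise gap] expresses both the order and the absence of adjacent
    digits 1. *)
Definition gap (i j : int) : bool := j + 2 <= i.

Section GoldenMean.
Variable R : realType.
Notation phi := (golden_mean R).

Lemma golden_mean_sqr : phi ^+ 2 = phi + 1.
Proof.
have s5 : Num.sqrt (5 : R) ^+ 2 = 5 by rewrite sqr_sqrtr //; lra.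
by rewrite /golden_mean; nra.
Qed.

Lemma golden_mean_gt1 : 1 < phi.
Proof.
have s0 : 0 <= Num.sqrt (5 : R) := sqrtr_ge0 _.
have := golden_mean_sqr; rewrite /golden_mean => h.
nra.
Qed.

Lemma golden_mean_expz_gt0 (i : int) : 0 < phi ^ i.
Proof. by apply: exprz_gt0; apply: lt_trans golden_mean_gt1. Qed.

Lemma golden_mean_expz_rec (i j k : int) :
  j = i + 1 -> k = i + 2 -> phi ^ k = phi ^ j + phi ^ i.
Proof.
have phi0 : phi != 0 by rewrite gt_eqF // (lt_trans _ golden_mean_gt1).
move=> -> ->; rewrite (expfzDr i 1) // (expfzDr i 2) // expr1z.
by rewrite -exprnP golden_mean_sqr mulrDr mulr1.
Qed.

Definition phi_sum (l : seq int) : R := \sum_(i <- l) phi ^ i.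

Lemma phi_sum_cons i l : phi_sum (i :: l) = phi ^ i + phi_sum l.
Proof. exact: big_cons. Qed.

Lemma phi_sum_rcons l i : phi_sum (rcons l i) = phi_sum l + phi ^ i.
Proof. by rewrite /phi_sum big_rcons. Qed.

Lemma phi_sum_ge0 l : 0 <= phi_sum l.
Proof. by apply: sumr_ge0 => i _; apply/ltW/golden_mean_expz_gt0. Qed.

(** The Zeckendorf bound, which drives the greedy argument for uniqueness: the
    exponents after [i] start at most at [i - 2], so by induction they
    contribute less than [phi ^ (i - 1) = phi ^ (i + 1) - phi ^ i]. *)
Lemma phi_sum_lt i l :
  pairwise gap (i :: l) -> phi_sum (i :: l) < phi ^ (i + 1).
Proof.
elim: l i => [|j l IH] i.
  rewrite phi_sum_cons /phi_sum big_nil addr0 => _.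
  by rewrite ltr_eXz2l ?golden_mean_gt1 //; lia.
rewrite pairwise_cons => /andP[/= /andP[gij _]] /IH jl.
rewrite phi_sum_cons (@golden_mean_expz_rec (i - 1) i (i + 1)); [|lia|lia].
rewrite ltrD2l; apply: (lt_le_trans jl).
rewrite ler_eXz2l ?golden_mean_gt1 //; move: gij; rewrite /gap; lia.
Qed.

(** The leading exponent [i] is determined by the value [v], since
    [phi ^ i <= v < phi ^ (i + 1)]; remove it and repeat. *)
Lemma phi_sum_inj l1 l2 :
  pairwise gap l1 -> pairwise gap l2 -> phi_sum l1 = phi_sum l2 -> l1 = l2.
Proof.
have phi_sum_head i l : phi ^ i <= phi_sum (i :: l).
  by rewrite phi_sum_cons lerDl phi_sum_ge0.
have nil_cons i l : phi_sum [::] <> phi_sum (i :: l).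
  move=> e; have := phi_sum_head i l; rewrite -e /phi_sum big_nil.
  by rewrite leNgt golden_mean_expz_gt0.
elim: l1 l2 => [|i l1 IH] [|j l2] // gl1 gl2 e; first by case: (nil_cons _ _ e).
  by case: (nil_cons i l1).
have eij : i = j.
  have := phi_sum_head i l1; rewrite e => /le_lt_trans/(_ (phi_sum_lt gl2)).
  have := phi_sum_head j l2; rewrite -e => /le_lt_trans/(_ (phi_sum_lt gl1)).
  by rewrite !ltr_eXz2l ?golden_mean_gt1 //; lia.
move: gl1 gl2; rewrite !pairwise_cons => /andP[_ gl1] /andP[_ gl2].
move: e; rewrite !phi_sum_cons eij => /addrI e.
by rewrite (IH l2).
Qed.

Lemma gap_irr : irreflexive gap.
Proof. by move=> i; rewrite /gap; lia. Qed.

Lemma gap_uniq l : pairwise gap l -> uniq l.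
Proof. exact: pairwise_uniq gap_irr. Qed.

Lemma expansion_of_seq N l : pairwise gap l -> phi_sum l = N%:R ->
  is_base_phi_expansion R N (fun i => i \in l).
Proof.
move=> gl vl; split.
- exact: finite_seq.
- move=> i; case: (boolP (i \in l)) => // il.
  case: (boolP (i + 1 \in l)) => // i1l.
  exfalso; elim: l gl il i1l {vl} => // j l IH.
  rewrite pairwise_cons !inE => /andP[/allP gj gl].
  case/predU1P=> [->|il]; case/predU1P=> [e|i1l]; first by lia.
  + by have := gj _ i1l; rewrite /gap; lia.
  + by have := gj _ il; rewrite /gap; lia.
  + exact: IH.
- rewrite -vl /phi_sum (@fsbigE _ _ _ _ _ l) ?gap_uniq //; last first.
    by move=> i _ /negbTE /= ->; rewrite mul0r.
  rewrite big_seq_cond [RHS]big_seq_cond; apply: eq_big => [i|i].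
    by rewrite in_setT.
  by move=> /andP[-> _]; rewrite mul1r.
Qed.

Lemma seq_of_expansion N d : is_base_phi_expansion R N d ->
  exists l, [/\ pairwise gap l, phi_sum l = N%:R & forall i, (i \in l) = d i].
Proof.
case=> fd nd vd.
pose l := sort >=%O (finmap.enum_fset (fset_set [set i | d i])).
have memd i : (i \in l) = d i.
  by rewrite mem_sort; apply/idP/idP; rewrite in_fset_set // inE.
have ul : uniq l by rewrite sort_uniq finmap.fset_uniq.
exists l; split=> //.
- have tr : transitive (>=%O : rel int).
    by move=> x y z xy yz; apply: le_trans yz xy.
  have : pairwise >=%O l.
    by rewrite -sorted_pairwise //; apply: sort_sorted => x y; lia.
  have : all d l by apply/allP => i; rewrite memd.
  move: ul; elim: (l) => // i s IH.
  rewrite cons_uniq !pairwise_cons => /andP[ni us] /= /andP[di ds].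
  case/andP=> [/allP ge_s ps]; rewrite IH // andbT; apply/allP => j js.
  have := ge_s _ js; have := allP ds _ js => dj ge_ij.
  have neij : i != j by apply: contraNneq ni => ->.
  have neij1 : i != j + 1.
    by apply/eqP => e; have := nd j; rewrite -e di dj.
  by move: ge_ij neij neij1; rewrite /gap /=; lia.
- rewrite vd (@fsbigE _ _ _ _ _ l) //; last first.
    by move=> i _; rewrite memd => /negbTE ->; rewrite mul0r.
  rewrite /phi_sum big_seq_cond [RHS]big_seq_cond; apply: eq_big => [i|i].
    by rewrite in_setT.
  by rewrite memd => /andP[-> _]; rewrite mul1r.
Qed.

Lemma s_beta_eq_size N l :
  pairwise gap l -> phi_sum l = N%:R -> s_beta R N = size l.
Proof.
move=> gl vl.
have : is_base_phi_expansion R N (base_phi_digits R N).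
  apply: (@xgetPex _ _ [set d | is_base_phi_expansion R N d]).
  by exists (fun i => i \in l); apply: expansion_of_seq.
case/seq_of_expansion=> l' [gl' vl' meml'].
have ll' : l' = l by apply: phi_sum_inj => //; rewrite vl vl'.
move: meml'; rewrite ll' => meml.
rewrite /s_beta (@fsbigE _ _ _ _ _ l) ?gap_uniq //; last first.
  by move=> i _; rewrite meml => /negbTE ->.
rewrite -sum1_size big_seq_cond [RHS]big_seq_cond; apply: eq_big => [i|i].
  by rewrite in_setT.
by rewrite meml => /andP[-> _].
Qed.
End GoldenMean.

(** * Lists of all expansions, built from three blocks *)

Definition enclose (i j : int) (l : seq int) : seq int := i :: rcons l j.

(** [expansions n] lists the expansions of 0, 1, ..., L_(2n+1) and
    [shifted_expansions n] those of k - phi^(-2n) for k = 1, ..., L_(2n) - 1,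
    both in increasing order.  At level 1 the middle block of the shifted list
    is empty because L_0 > L_1: there is no level -1. *)
Fixpoint expansions (n : nat) : seq (seq int) :=
  if n is m.+1 then
    expansions m
    ++ map (enclose (2 * m%:Z + 1) (- 2 * m%:Z - 2)) (shifted_expansions m)
    ++ map (enclose (2 * m%:Z + 2) (- 2 * m%:Z - 2)) (expansions m)
  else [:: [::]; [:: 0]]
with shifted_expansions (n : nat) : seq (seq int) :=
  if n is m.+1 then
    map (rcons^~ (- 2 * m%:Z - 1)) (shifted_expansions m)
    ++ map (enclose (2 * m%:Z) (- 2 * m%:Z - 1))
         (if m is k.+1 then expansions k else [::])
    ++ map (cons (2 * m%:Z + 1)) (shifted_expansions m)
  else [:: [::]].

(** The recursion for shifted expansions looks back two levels, so inductions
    carry this list along with the two lists of level [n]. *)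
Definition previous_expansions n := if n is k.+1 then expansions k else [::].

Lemma expansions0 : expansions 0 = [:: [::]; [:: 0]].
Proof. by []. Qed.

Lemma shifted_expansions0 : shifted_expansions 0 = [:: [::]].
Proof. by []. Qed.

Lemma expansionsS n : expansions n.+1 =
  expansions n
  ++ map (enclose (2 * n%:Z + 1) (- 2 * n%:Z - 2)) (shifted_expansions n)
  ++ map (enclose (2 * n%:Z + 2) (- 2 * n%:Z - 2)) (expansions n).
Proof. by []. Qed.

Lemma shifted_expansionsS n : shifted_expansions n.+1 =
  map (rcons^~ (- 2 * n%:Z - 1)) (shifted_expansions n)
  ++ map (enclose (2 * n%:Z) (- 2 * n%:Z - 1)) (previous_expansions n)
  ++ map (cons (2 * n%:Z + 1)) (shifted_expansions n).
Proof. by []. Qed.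

(* Otherwise the conversions tried by [lia] and [lra] unfold the lists. *)
Opaque expansions shifted_expansions.

Lemma size_expansionsS n : size (expansions n.+1) =
  (2 * size (expansions n) + size (shifted_expansions n))%N.
Proof. by rewrite expansionsS !size_cat !size_map; lia. Qed.

Lemma size_shifted_expansionsS n : size (shifted_expansions n.+1) =
  (2 * size (shifted_expansions n) + size (previous_expansions n))%N.
Proof.
by rewrite shifted_expansionsS !size_cat !size_map addnCA addnn -mul2n addnC.
Qed.

(** This is L_(2n+1) = L_(2n) + L_(2n-1). *)
Lemma size_expansionsE n : size (expansions n) =
  (size (shifted_expansions n) + 1 + size (previous_expansions n))%N.
Proof.
elim: n => // n IH.
by rewrite size_expansionsS size_shifted_expansionsS /=; lia.
Qed.

(** The window [a, b] of exponents is what leaves room, at the next level, for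
    the new exponents outside it. *)
Definition admissible_in (a b : int) (l : seq int) : bool :=
  pairwise gap l && all (fun i => a <= i <= b) l.

Lemma admissible_in_widen a b a' b' l :
  a' <= a -> b <= b' -> admissible_in a b l -> admissible_in a' b' l.
Proof.
move=> aa bb /andP[gl /allP il]; rewrite /admissible_in gl /=.
by apply/allP => i /il; lia.
Qed.

Lemma admissible_in_cons a a' b b' i l :
  b' + 2 <= i -> a <= i <= b -> a <= a' -> admissible_in a' b' l ->
  admissible_in a b (i :: l).
Proof.
move=> bi ib aa /andP[gl /allP il].
rewrite /admissible_in pairwise_cons gl /= ib andbT.
by apply/andP; split; apply/allP => k /il; rewrite /gap; lia.
Qed.

Lemma admissible_in_rcons a a' b b' i l :
  i + 2 <= a' -> a <= i <= b -> b' <= b -> admissible_in a' b' l ->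
  admissible_in a b (rcons l i).
Proof.
move=> ia ib bb /andP[gl /allP il].
rewrite /admissible_in pairwise_rcons gl all_rcons /= ib andbT.
by apply/andP; split; apply/allP => k /il; rewrite /gap; lia.
Qed.

Lemma admissible_in_enclose a a' b b' i j l :
  b' + 2 <= i <= b -> a <= j -> j + 2 <= a' -> j + 2 <= i ->
  admissible_in a' b' l -> admissible_in a b (enclose i j l).
Proof.
move=> bi aj ja ji adl; apply: (@admissible_in_cons _ a _ (i - 2)); [lia..|].
by apply: admissible_in_rcons adl; lia.
Qed.

Lemma expansions_admissible n :
  all (admissible_in (- 2 * n%:Z) (2 * n%:Z)) (expansions n) /\
  all (admissible_in (- 2 * n%:Z + 1) (2 * n%:Z - 1)) (shifted_expansions n).
Proof.
suff [] : [/\ all (admissible_in (- 2 * n%:Z) (2 * n%:Z)) (expansions n),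
    all (admissible_in (- 2 * n%:Z + 1) (2 * n%:Z - 1)) (shifted_expansions n)
  & all (admissible_in (- 2 * n%:Z + 2) (2 * n%:Z - 2))
      (previous_expansions n)] by [].
elim: n => [|n [/allP aE /allP aS /allP aP]].
  by rewrite expansions0 shifted_expansions0.
split.
- rewrite expansionsS !all_cat !all_map.
  apply/and3P; split; apply/allP => l.
  + by move=> /aE; apply: admissible_in_widen; lia.
  + by move=> /aS; apply: admissible_in_enclose; lia.
  + by move=> /aE; apply: admissible_in_enclose; lia.
- rewrite shifted_expansionsS !all_cat !all_map.
  apply/and3P; split; apply/allP => l.
  + by move=> /aS; apply: admissible_in_rcons; lia.
  + by case: n aP {aE aS} => [|n] aP // /aP; apply: admissible_in_enclose; lia.
  + by move=> /aS; apply: admissible_in_cons; lia.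
- by apply/allP => l /aE; apply: admissible_in_widen; lia.
Qed.

(** * Values of the listed expansions *)

Section Values.
Variable R : realType.
Notation phi := (golden_mean R).

Lemma phi_sum_enclose i j l :
  phi_sum R (enclose i j l) = phi_sum R l + (phi ^ i + phi ^ j).
Proof. by rewrite phi_sum_cons phi_sum_rcons; lra. Qed.

Definition runs_from (a : R) (s : seq (seq int)) : Prop :=
  forall k, (k < size s)%N -> phi_sum R (nth [::] s k) = a + k%:R.

Lemma runs_from_cat a b s t :
  b = a + (size s)%:R -> runs_from a s -> runs_from b t -> runs_from a (s ++ t).
Proof.
move=> -> rs rt k; rewrite size_cat nth_cat => kst.
have [ks|sk] := ltnP k (size s); first exact: rs.
by rewrite rt ?ltn_subLR // -addrA -natrD subnKC.
Qed.

Lemma runs_from_map f c a b s :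
  (forall l, phi_sum R (f l) = phi_sum R l + c) -> b = a + c ->
  runs_from a s -> runs_from b (map f s).
Proof.
move=> fc -> rs k; rewrite size_map => ks.
by rewrite (nth_map [::]) // fc rs //; lra.
Qed.

(** The Binet formulas for L_(2n+1) + 1 and L_(2n) - 1; they give the offsets at
    which the second and third block start. *)
Lemma size_expansions_phi n :
  (size (expansions n))%:R =
    1 + phi ^ (2 * n%:Z + 1) - phi ^ (- 2 * n%:Z - 1) /\
  (size (shifted_expansions n))%:R =
    phi ^ (2 * n%:Z) + phi ^ (- 2 * n%:Z) - 1.
Proof.
elim: n => [|n [IHe IHs]].
  have := @golden_mean_expz_rec R (- 1) 0 1 erefl erefl.
  rewrite expansions0 shifted_expansions0 !mulr0 !add0r expr0z /= => r.
  by move: (phi ^ (- 1)) (phi ^ 1) r => u v r; split; lra.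
have es := congr1 (fun k => k%:R : R) (size_expansionsE n).
rewrite !natrD in es.
rewrite size_expansionsS size_shifted_expansionsS 2!natrD 2!natrM.
have r1 : phi ^ (2 * n.+1%:Z) = phi ^ (2 * n%:Z + 1) + phi ^ (2 * n%:Z).
  by apply: golden_mean_expz_rec; lia.
have r2 : phi ^ (2 * n.+1%:Z + 1) = phi ^ (2 * n.+1%:Z) + phi ^ (2 * n%:Z + 1).
  by apply: golden_mean_expz_rec; lia.
have r3 : phi ^ (- 2 * n%:Z) = phi ^ (- 2 * n%:Z - 1) + phi ^ (- 2 * n.+1%:Z).
  by apply: golden_mean_expz_rec; lia.
have r4 : phi ^ (- 2 * n%:Z - 1) =
    phi ^ (- 2 * n.+1%:Z) + phi ^ (- 2 * n.+1%:Z - 1).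
  by apply: golden_mean_expz_rec; lia.
by split; lra.
Qed.

(** Every block is a translate of a run, so it is a run; it remains to see that
    each block starts one after the end of its predecessor, which follows from
    the Binet formulas. *)
Lemma expansions_run n :
  runs_from 0 (expansions n) /\
  runs_from (1 - phi ^ (- 2 * n%:Z)) (shifted_expansions n).
Proof.
suff [] : [/\ runs_from 0 (expansions n),
  runs_from (1 - phi ^ (- 2 * n%:Z)) (shifted_expansions n)
  & runs_from 0 (previous_expansions n)] by [].
elim: n => [|n [rE rS rP]].
  rewrite expansions0 shifted_expansions0; split=> //.
  - case=> [|[|//]] _; first by rewrite /= /phi_sum big_nil addr0.
    by rewrite /= phi_sum_cons /phi_sum big_nil expr0z addr0 add0r.
  - by case=> // _; rewrite mulr0 expr0z /= /phi_sum big_nil; lra.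
have es := congr1 (fun k => k%:R : R) (size_expansionsE n).
rewrite !natrD in es.
have [se ss] := size_expansions_phi n.
have r1 : phi ^ (2 * n%:Z + 2) = phi ^ (2 * n%:Z + 1) + phi ^ (2 * n%:Z).
  by apply: golden_mean_expz_rec; lia.
have r3 : phi ^ (- 2 * n%:Z) = phi ^ (- 2 * n%:Z - 1) + phi ^ (- 2 * n%:Z - 2).
  by apply: golden_mean_expz_rec; lia.
have e2 : phi ^ (- 2 * n.+1%:Z) = phi ^ (- 2 * n%:Z - 2) by congr (_ ^ _); lia.
split=> //.
- rewrite expansionsS.
  apply: (@runs_from_cat _ (size (expansions n))%:R) => //.
    by rewrite add0r.
  apply: (@runs_from_cat _ (phi ^ (2 * n%:Z + 2) + phi ^ (- 2 * n%:Z - 2))).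
  + by rewrite size_map; lra.
  + by apply: (runs_from_map (phi_sum_enclose _ _) _ rS); lra.
  + by apply: (runs_from_map (phi_sum_enclose _ _) _ rE); lra.
- rewrite shifted_expansionsS.
  apply: (@runs_from_cat _ (phi ^ (2 * n%:Z) + phi ^ (- 2 * n%:Z - 1))).
  + by rewrite size_map; lra.
  + by apply: (runs_from_map (fun l => phi_sum_rcons R l _) _ rS); lra.
  apply: (@runs_from_cat _ (phi ^ (2 * n%:Z + 1) + (1 - phi ^ (- 2 * n%:Z)))).
  + by rewrite size_map; lra.
  + by apply: (runs_from_map (phi_sum_enclose _ _) _ rP); lra.
  + apply: (@runs_from_map _ (phi ^ (2 * n%:Z + 1)) _ _ _ _ _ rS); last by lra.
    by move=> l; rewrite phi_sum_cons addrC.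
Qed.

Lemma s_beta_expansions n k : (k < size (expansions n))%N ->
  s_beta R k = size (nth [::] (expansions n) k).
Proof.
move=> kn; apply: s_beta_eq_size.
  have [/allP aE _] := expansions_admissible n.
  by have /aE /andP[] := mem_nth [::] kn.
by have [-> //] := expansions_run n; rewrite add0r.
Qed.
End Values.

(** * Cancellation in the sums of signs *)

Section Signs.
Variable R : realType.

Definition sign_sum (s : seq (seq int)) : R := \sum_(l <- s) (-1) ^+ size l.

Lemma sign_sum_cat s t : sign_sum (s ++ t) = sign_sum s + sign_sum t.
Proof. exact: big_cat. Qed.

Lemma sign_sum_map f c s :
  (forall l, size (f l) = (size l + c)%N) ->
  sign_sum (map f s) = (-1) ^+ c * sign_sum s.
Proof.
move=> fc; rewrite /sign_sum big_map mulr_sumr.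
by apply: eq_bigr => l _; rewrite fc exprD mulrC.
Qed.

(** Partial sums are controlled along with full block sums, because an arbitrary
    [M] stops inside a block. *)
Definition prefix_bounded (B : R) s := forall m, `|sign_sum (take m s)| <= B.

(** A prefix of a concatenation either stops in [s], or contains all of [s] and
    then stops in [t]. *)
Lemma prefix_bounded_cat a b c s t :
  prefix_bounded a s -> prefix_bounded b t ->
  a <= c -> `|sign_sum s| + b <= c -> prefix_bounded c (s ++ t).
Proof.
move=> sa tb ac sbc m; rewrite take_cat; case: ifP => _.
  exact: le_trans (sa m) ac.
rewrite sign_sum_cat; apply: le_trans (ler_normD _ _) (le_trans _ sbc).
by rewrite lerD2l.
Qed.

Lemma prefix_bounded_map f c b s :
  (forall l, size (f l) = (size l + c)%N) ->
  prefix_bounded b s -> prefix_bounded b (map f s).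
Proof.
move=> fc sb m; rewrite -map_take (sign_sum_map _ fc).
by rewrite normrM normrX normrN1 expr1n mul1r.
Qed.

Lemma size_enclose i j l : size (enclose i j l) = (size l + 2)%N.
Proof. by rewrite /= size_rcons addn2. Qed.

Lemma size_rcons_add1 (i : int) l : size (rcons l i) = (size l + 1)%N.
Proof. by rewrite size_rcons addn1. Qed.

Lemma size_cons_add1 (i : int) l : size (i :: l) = (size l + 1)%N.
Proof. by rewrite addn1. Qed.

Lemma sign_sum_expansionsS n : sign_sum (expansions n.+1) =
  2 * sign_sum (expansions n) + sign_sum (shifted_expansions n).
Proof.
rewrite expansionsS !sign_sum_cat !(sign_sum_map _ (size_enclose _ _)).
by rewrite sqrrN expr1n; ring.
Qed.

Lemma sign_sum_shifted_expansionsS n : sign_sum (shifted_expansions n.+1) =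
  sign_sum (previous_expansions n) - 2 * sign_sum (shifted_expansions n).
Proof.
rewrite shifted_expansionsS !sign_sum_cat (sign_sum_map _ (size_enclose _ _)).
rewrite (sign_sum_map _ (size_rcons_add1 _)).
rewrite (sign_sum_map _ (size_cons_add1 _)).
by rewrite sqrrN expr1n expr1; ring.
Qed.

(** Substituting one recurrence into the other cancels the sums over shifted
    expansions and leaves T_(n+2) = 4 T_n + T_(n-1); the rate r = 9/4 works as
    4 + 1/r <= r^2.  Bounding the two recurrences separately, without this
    cancellation, would only give the rate phi^2, the growth rate of the number
    of terms. *)
Lemma sign_sum_bound n :
  [/\ `|sign_sum (previous_expansions n)| <= 4 / 9 * (9 / 4) ^+ n,
      `|sign_sum (expansions n)| <= (9 / 4) ^+ n
    & `|sign_sum (expansions n.+1)| <= 9 / 4 * (9 / 4) ^+ n].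
Proof.
elim: n => [|n [IHp IHe IHe1]].
  rewrite sign_sum_expansionsS expansions0 shifted_expansions0 /sign_sum.
  rewrite !big_cons !big_nil /= expr0 expr1 !ler_norml.
  by split; lra.
have r0 : 0 <= (9 / 4 : R) ^+ n by apply: exprn_ge0; lra.
split; [|by rewrite exprS|].
  by rewrite exprS /=; lra.
have -> : sign_sum (expansions n.+2) =
    4 * sign_sum (expansions n) + sign_sum (previous_expansions n).
  rewrite sign_sum_expansionsS sign_sum_shifted_expansionsS.
  by rewrite sign_sum_expansionsS; ring.
move: IHp IHe; rewrite !exprS !ler_norml => /andP[? ?] /andP[? ?].
by apply/andP; split; lra.
Qed.

(** A prefix at level [n + 1] is at most two full blocks, whose sums are known,
    followed by a prefix of a block.  The constant 5 absorbs the full blocks: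
    their sums total less than 5 (9/4 - 1) (9/4)^n. *)
Lemma prefix_bounded_expansions n :
  prefix_bounded (5 * (9 / 4) ^+ n) (expansions n).
Proof.
(* The shifted and the previous lists enter the recursion, so the three bounds
   are proved together. *)
suff [] : [/\ prefix_bounded (5 * (9 / 4) ^+ n) (expansions n),
  prefix_bounded (5 * (9 / 4) ^+ n) (shifted_expansions n)
  & prefix_bounded (5 * (9 / 4) ^+ n) (previous_expansions n)] by [].
elim: n => [|n [IHe IHs IHp]].
  rewrite expansions0 shifted_expansions0 expr0.
  split=> m; first case: m => [|[|m]]; try case: m => [|m];
    rewrite /sign_sum /= ?big_cons ?big_nil /= ?expr0 ?expr1 ler_norml; lra.
have r0 : 0 <= (9 / 4 : R) ^+ n by apply: exprn_ge0; lra.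
have [bp be] := sign_sum_bound n; rewrite sign_sum_expansionsS => be1.
(* Q_n = T_(n+1) - 2 T_n, and 9/4 + 2 = 17/4. *)
have bs : `|sign_sum (shifted_expansions n)| <= 17 / 4 * (9 / 4) ^+ n.
  move: be be1; rewrite !ler_norml => /andP[? ?] /andP[? ?].
  by apply/andP; split; lra.
have be5 : 5 * (9 / 4) ^+ n <= 5 * (9 / 4) ^+ n.+1 :> R by rewrite exprS; lra.
split.
- rewrite expansionsS.
  apply: (@prefix_bounded_cat _ (37 / 4 * (9 / 4) ^+ n) _ _ _ IHe) => //;
    last first.
    by rewrite exprS; lra.
  apply: prefix_bounded_cat.
  + exact: prefix_bounded_map (size_enclose _ _) IHs.
  + exact: prefix_bounded_map (size_enclose _ _) IHe.
  + by lra.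
  + by rewrite (sign_sum_map _ (size_enclose _ _)) sqrrN expr1n mul1r; lra.
- rewrite shifted_expansionsS.
  apply: (@prefix_bounded_cat _ (6 * (9 / 4) ^+ n) _ _ _
           (prefix_bounded_map (size_rcons_add1 _) IHs)) => //; last first.
    rewrite (sign_sum_map _ (size_rcons_add1 _)) expr1 mulN1r normrN exprS; lra.
  apply: prefix_bounded_cat.
  + exact: prefix_bounded_map (size_enclose _ _) IHp.
  + exact: prefix_bounded_map (size_cons_add1 _) IHs.
  + by lra.
  + by rewrite (sign_sum_map _ (size_enclose _ _)) sqrrN expr1n mul1r; lra.
- by move=> m; apply: le_trans (IHe m) be5.
Qed.

(** The lists grow by a factor close to phi^2 > 5/2.  The induction closes for
    L_(2n+1) >= (5/2)^n, and L_(2n+1) is one less than the size of the list. *)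
Lemma size_expansions_ge n : (5 / 2) ^+ n + 1 <= (size (expansions n))%:R :> R.
Proof.
have prev_le m :
  (size (previous_expansions m) <= size (shifted_expansions m) + 2)%N.
  case: m => // m.
  by rewrite size_shifted_expansionsS /= size_expansionsE; lia.
elim: n => [|n IH]; first by rewrite expr0 expansions0 /=; lra.
have es := congr1 (fun k => k%:R : R) (size_expansionsE n).
rewrite !natrD in es.
move: (prev_le n) IH; rewrite size_expansionsS exprS -(ler_nat R).
by rewrite 2!natrD natrM; lra.
Qed.

(** * From the sums of signs to frequencies *)

Definition discrepancy M : R := \sum_(k < M) (-1) ^+ s_beta R k.

Lemma discrepancy_bound n M : (M <= size (expansions n))%N ->
  `|discrepancy M| <= 5 * (9 / 4) ^+ n.
Proof.
move=> Mn; apply: le_trans (prefix_bounded_expansions n M).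
rewrite le_eqVlt; apply/orP; left; apply/eqP; congr `|_|.
rewrite /discrepancy /sign_sum (big_nth [::]) size_takel // big_mkord.
apply: eq_bigr => k _; rewrite nth_take // (@s_beta_expansions R n) //.
exact: leq_trans (ltn_ord k) Mn.
Qed.

(** If [M] lies between the sizes at levels [m] and [m + 1], with [n <= m], then
    the discrepancy is at most 5 (9/4)^(m+1) while [M] is at least (5/2)^m; the
    quotient is 45/4 (9/10)^m. *)
Lemma discrepancy_small n M : (size (expansions n) < M)%N ->
  `|discrepancy M| <= 45 / 4 * (9 / 10) ^+ n * M%:R.
Proof.
move=> nM.
(* Some level contains [M]; the induction runs over the levels up to it. *)
have : (M <= size (expansions (n + M)))%N.
  rewrite -(ler_nat R); apply: le_trans (size_expansions_ge _).
  have : M%:R <= (5 / 2 : R) ^+ M.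
    elim: (M) => [|k IH]; first by rewrite expr0.
    have : 1 <= (5 / 2 : R) ^+ k by apply: exprn_ege1; lra.
    by rewrite -[k.+1]addn1 exprD natrD expr1; lra.
  have : 1 <= (5 / 2 : R) ^+ n by apply: exprn_ege1; lra.
  by have := ler0n R M; rewrite exprD; nra.
elim: {2}M => [|j IH]; first by rewrite addn0 leqNgt nM.
have [/IH//|njM] := leqP M (size (expansions (n + j))).
rewrite addnS => /discrepancy_bound; move/le_trans; apply.
have -> : 5 * (9 / 4) ^+ (n + j).+1 =
    45 / 4 * (9 / 10) ^+ (n + j) * (5 / 2) ^+ (n + j) :> R.
  have -> : 9 / 4 = 9 / 10 * (5 / 2) :> R by lra.
  by move: (n + j)%N => m; rewrite exprS exprMn; field.
have b0 k : 0 <= (9 / 10 : R) ^+ k by apply: exprn_ge0; lra.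
apply: ler_pM; rewrite ?mulr_ge0 ?b0 ?exprn_ge0 //; try lra.
  rewrite ler_pM2l; last by lra.
  rewrite exprD ler_piMr //.
  by apply: exprn_ile1; lra.
apply: le_trans (_ : (size (expansions (n + j)))%:R <= _); last first.
  by rewrite ler_nat ltnW.
by have := size_expansions_ge (n + j); lra.
Qed.

(** The indicator of [x_beta R k = a] is the average of 1 and
    [(-1) ^+ a * (-1) ^+ s_beta R k]. *)
Lemma card_x_beta a M : (a < 2)%N ->
  #|[pred N : 'I_M | x_beta R N == a]|%:R =
    (M%:R + (-1) ^+ a * discrepancy M) / 2 :> R.
Proof.
move=> a2; rewrite -sum1_card natr_sum big_mkcond /=.
have -> : M%:R = \sum_(k < M) 1 :> R by rewrite sumr_const card_ord.
rewrite /discrepancy mulr_sumr -big_split mulr_suml /=.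
apply: eq_bigr => k _; rewrite inE /x_beta modn2 -(signr_odd _ (s_beta R k)).
by move: a a2 => [|[|//]] _; case: (odd _); rewrite /= ?expr0 ?expr1; lra.
Qed.
End Signs.

Theorem proposition7 (R : realType) :
  has_frequency (x_beta R) 0%N (1 / 2 : R)%R /\
  has_frequency (x_beta R) 1%N (1 / 2 : R)%R.
Proof.
suff freq a : (a < 2)%N -> has_frequency (x_beta R) a (1 / 2 : R).
  by split; exact: freq.
move=> a2; apply/cvgrPdist_le => eps eps0.
have geo : (9 / 10 : R) ^+ n @[n --> \oo] --> (0 : R).
  by apply: cvg_expr; rewrite ger0_norm; lra.
(* The final bound is 45/8 times this power, and 45/8 < 6. *)
have : \forall n \near \oo, `|0 - (9 / 10 : R) ^+ n| <= eps / 6.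
  by move/cvgrPdist_le: geo; apply; lra.
case=> n _ /(_ n (leqnn n)).
rewrite sub0r normrN ger0_norm; last by apply: exprn_ge0; lra.
move=> n_eps; near=> M.
have nM : (size (expansions n) < M)%N by near: M; exact: nbhs_infty_gt.
have M0 : 0 < M%:R :> R by rewrite ltr0n; apply: leq_ltn_trans nM.
have -> : 1 / 2 - #|[pred N : 'I_M | x_beta R N == a]|%:R / M%:R =
    - ((-1) ^+ a * discrepancy R M) / (2 * M%:R) :> R.
  by rewrite card_x_beta //; field; rewrite gt_eqF.
rewrite normrM normrN normrM normrX normrN1 expr1n mul1r.
have -> : `|(2 * M%:R)^-1| = (2 * M%:R)^-1 :> R.
  by rewrite ger0_norm // invr_ge0; lra.
rewrite ler_pdivrMr; last by lra.
by apply: le_trans (discrepancy_small R nM) _; nra.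
Unshelve. all: by end_near.
Qed.
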